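(* Let $s\ge 1$ and $n\ge 1$ be integers and let $A_1,\dots,A_s$ be complex constants with $A_i\neq 0$ for some $i$. Consider the recurrence relation $$x(m)=A_1x(m-1)+A_2x(m-2)+\cdots+A_sx(m-s)\qquad (m\in\mathbb{Z}).\qquad ( * )$$ Then every product of $n$ functions, each of which satisfies $( * )$, admits a linear recurrence relation with constant coefficients, and any two such products satisfy the same recurrence relation. That is, there exist an integer $N\ge 1$ and constants $B_1,\dots,B_N\in\mathbb{C}$ (depending only on $n$ and $A_1,\dots,A_s$) such that for all functions $x_1,\dots,x_n:\mathbb{Z}\to\mathbb{C}$ each satisfying $( * )$, the product $X(m)=x_1(m)x_2(m)\cdots x_n(m)$ satisfies $$X(m)=B_1X(m-1)+B_2X(m-2)+\cdots+B_NX(m-N)\qquad\text{for all } m\in\mathbb{Z}.$$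
   Context: A function $x:\mathbb{Z}\to\mathbb{C}$ ''satisfies $( * )$'' if the identity $( * )$ holds for every $m\in\mathbb{Z}$. The $n$ functions in a product need not be distinct. *)

(* Defs.v *)
From mathcomp Require Export all_boot all_order all_algebra.
From mathcomp Require Export reals.
From mathcomp.real_closed Require Export complex.

Set Implicit Arguments.
Unset Strict Implicit.
Unset Printing Implicit Defensive.

Export GRing.Theory Num.Theory.

Local Open Scope ring_scope.

(* Indices start at 0 here: [A i] is the coefficient of [x (m - (i + 1))]. *)
Definition satisfies_recurrence (K : nzRingType) (s : nat) (A : 'I_s -> K)
    (x : int -> K) : Prop :=
  forall m : int, x m = \sum_(i < s) A i * x (m - i.+1%:Z).

(* Main.v *)
Require Import Defs.
From mathcomp Require Import all_boot all_order all_algebra.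
From mathcomp Require Import reals.
From mathcomp.real_closed Require Import complex.

(** A solution of a recurrence of order [s] is determined by a window of [s]
    consecutive values, and sliding this window by one step is a linear map that
    depends only on the coefficients (the companion matrix).  For [n] solutions,
    take the tensor product of their windows: the entries of this vector are the
    products of shifted values [\prod_j x j (m - f j)], one for each [f] from
    ['I_n] to ['I_s].  By distributivity the tensor vector also evolves by a fixed
    matrix, the [n]-th tensor power of the companion matrix
    ([tensor_window_step]).  The Cayley-Hamilton theorem turns any such matrix
    evolution into a scalar recurrence, whose coefficients are those of the
    characteristic polynomial, satisfied by every entry of the vector
    ([matrix_evolution_recurrence]).  The product of the [n] solutions is the
    entry at [f = 0], so it satisfies a recurrence of order [s ^ n] that does not
    depend on the chosen solutions. *)

Local Open Scope ring_scope.

(** Cayley-Hamilton applied to the orbit of [T (m - d)]: the characteristic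
    polynomial is monic of degree [d], so its relation expresses [T m] through the
    [d] preceding vectors. *)
Lemma matrix_evolution_recurrence (K : comNzRingType) (d : nat) (M : 'M[K]_d)
    (T : int -> 'cV[K]_d) (i : 'I_d) :
  (forall m, T (m + 1) = M *m T m) ->
  satisfies_recurrence (fun k : 'I_d => - (char_poly M)`_(d - k.+1))
    (fun m => T m i 0).
Proof.
case: d M T i => [|d] M T i T_step m; first by case: i.
have T_iter (k : nat) m' : T (m' + k%:Z) = M ^+ k *m T m'.
  elim: k => [|k IHk]; first by rewrite addr0 expr0 mul1mx.
  by rewrite -[in LHS]addn1 PoszD addrA T_step IHk mulmxA exprS.
have CH : \sum_(k < d.+2) (char_poly M)`_k *: M ^+ k = 0.
  rewrite -[RHS](Cayley_Hamilton M) -[X in horner_mx M X]coefK poly_def.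
  rewrite size_char_poly raddf_sum /=; apply: eq_bigr => k _.
  by rewrite linearZ /= rmorphXn /= horner_mx_X.
pose m0 : int := m - d.+1%:Z.
have : \sum_(k < d.+2) (char_poly M)`_k * T (m0 + k%:Z) i 0 = 0.
  have /matrixP/(_ i 0) := congr1 (mulmx^~ (T m0)) CH.
  rewrite mulmx_suml mul0mx summxE mxE => CHi; rewrite -[RHS]CHi.
  by apply: eq_bigr => k _; rewrite T_iter -scalemxAl [RHS]mxE.
have lead1 : (char_poly M)`_d.+1 = 1.
  by have /monicP := char_poly_monic M; rewrite lead_coefE size_char_poly.
rewrite big_ord_recr /= lead1 mul1r subrK addrC => /eqP.
rewrite addr_eq0 => /eqP ->.
rewrite -sumrN (reindex_inj rev_ord_inj) /=; apply: eq_bigr => k _.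
by rewrite mulNr /m0 -subzn // addrA subrK.
Qed.

(** Entries of the companion matrix, acting on the window
    [(x m, x (m - 1), ..., x (m - s))]. *)
Definition companion_coef {K : nzRingType} {s : nat} (A : 'I_s.+1 -> K)
    (a b : 'I_s.+1) : K :=
  if val a is a'.+1 then (b == a' :> nat)%:R else A b.

Lemma window_step (K : nzRingType) (s : nat) (A : 'I_s.+1 -> K) (x : int -> K)
    (m : int) (a : 'I_s.+1) :
  satisfies_recurrence A x ->
  x (m + 1 - (a : nat)%:Z)
    = \sum_(b < s.+1) companion_coef A a b * x (m - (b : nat)%:Z).
Proof.
move=> xrec; rewrite /companion_coef; case: a => -[|a] lt_a /=.
  rewrite subr0 xrec; apply: eq_bigr => b _.
  by rewrite -[b.+1]add1n PoszD opprD addrA addrK.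
rewrite (bigD1 (Ordinal (ltnW lt_a))) //= eqxx mul1r big1 ?addr0 => [|b neq_ba].
  by rewrite -[a.+1]add1n PoszD opprD addrA addrK.
by rewrite -val_eqE /= in neq_ba; rewrite (negPf neq_ba) mul0r.
Qed.

(** Expanding a product of sums over all choice functions [g]: the coefficients
    are the entries of the tensor power of the companion matrix, and do not
    involve [x]. *)
Lemma tensor_window_step (K : comNzRingType) (s n : nat) (A : 'I_s.+1 -> K)
    (x : 'I_n -> int -> K) (m : int) (f : {ffun 'I_n -> 'I_s.+1}) :
  (forall j, satisfies_recurrence A (x j)) ->
  \prod_(j < n) x j (m + 1 - (f j : nat)%:Z)
    = \sum_(g : {ffun 'I_n -> 'I_s.+1})
        (\prod_(j < n) companion_coef A (f j) (g j))
        * \prod_(j < n) x j (m - (g j : nat)%:Z).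
Proof.
move=> xrec; under eq_bigr => j _ do rewrite (window_step _ _ A _ m (f j) (xrec j)).
by rewrite bigA_distr_bigA; apply: eq_bigr => g _; rewrite big_split.
Qed.

Local Open Scope complex_scope.

Theorem proposition2p3 (R : realType) (s n : nat) (hs : (1 <= s)%N)
    (hn : (1 <= n)%N) (A : 'I_s -> R[i]) (hA : exists i : 'I_s, A i <> 0) :
  exists (N : nat) (B : 'I_N -> R[i]),
    (1 <= N)%N /\
    forall x : 'I_n -> int -> R[i],
      (forall j : 'I_n, satisfies_recurrence A (x j)) ->
      satisfies_recurrence B (fun m : int => \prod_(j < n) x j m).
Proof.
case: s hs A {hA} => // s _ A.
pose I : finType := {ffun 'I_n -> 'I_s.+1}.
pose M : 'M[R[i]]_#|I| := \matrix_(p, q)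
  \prod_(j < n) companion_coef A ((enum_val p : I) j) ((enum_val q : I) j).
pose f0 : I := [ffun=> ord0].
exists #|I|, (fun k => - (char_poly M)`_(#|I| - k.+1)); split.
  by apply/card_gt0P; exists f0.
move=> x xrec m.
pose T (m : int) : 'cV[R[i]]_#|I| :=
  \col_p \prod_(j < n) x j (m - ((enum_val p : I) j : nat)%:Z).
have T_step m' : T (m' + 1) = M *m T m'.
  apply/matrixP => p q; rewrite !mxE (tensor_window_step _ _ _ _ _ _ _ xrec).
  rewrite (reindex (@enum_val I I)) /=; last exact/onW_bij/enum_val_bij.
  by apply: eq_bigr => r _; rewrite !mxE.
have T0 m' : T m' (enum_rank f0) 0 = \prod_(j < n) x j m'.
  by rewrite mxE enum_rankK; apply: eq_bigr => j _; rewrite ffunE subr0.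
rewrite -T0 (matrix_evolution_recurrence _ _ _ _ (enum_rank f0) T_step).
by apply: eq_bigr => k _; rewrite T0.
Qed.
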